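(* Let $X$ and $Y$ be locally compact Polish spaces, $\mu\in\mathcal{P}(X)$, $\nu\in\mathcal{P}(Y)$, and let $c:X\times Y\to\mathbb{R}\cup\{+\infty\}$ be Borel-measurable. A transport plan $\pi\in\Pi(\mu,\nu)$ with finite cost $\mathcal{C}(\pi)<\infty$ is optimal for the problem $\min_{\gamma\in\Pi(\mu,\nu)}\mathcal{C}(\gamma)$ if and only if $\mathcal{C}(\eta)\ge0$ for all $\eta\in\mathcal{R}_\pi$.
   Context: $\mathcal{M}(X\times Y)$ is the set of finite signed Radon measures on $X\times Y$. $\Pi(\mu,\nu)$ is the set of Borel probability measures on $X\times Y$ with marginals $\mu$ and $\nu$. The cost functional is $\mathcal{C}(\eta):=\int_{X\times Y}c(x,y)\,\eta(dx,dy)$, extended linearly to signed measures, i.e. $\mathcal{C}(\eta)=\mathcal{C}(\eta^+)-\mathcal{C}(\eta^-)$ where $\eta=\eta^+-\eta^-$ is the decomposition into positive and negative parts. The radial cone to $\Pi(\mu,\nu)$ at $\pi$ is $$\mathcal{R}_\pi:=\{\eta\in\mathcal{M}(X\times Y):\ \pi+t\eta\in\Pi(\mu,\nu)\text{ for some }t>0\}.$$ *)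

(* Defs.v *)
(* MathComp-Analysis *)
From HB Require Import structures.
From mathcomp Require Import all_boot all_order all_algebra.
From mathcomp Require Import all_classical all_reals all_analysis.
From mathcomp Require Import measurable_realfun.

Set Implicit Arguments.
Unset Strict Implicit.
Unset Printing Implicit Defensive.

Import Order.TTheory GRing.Theory Num.Theory.

Local Open Scope classical_set_scope.
Local Open Scope ring_scope.
Local Open Scope ereal_scope.

Definition complete_metric (R : realType) (T : topologicalType)
    (d : T -> T -> R) : Prop :=
  [/\ (forall x y, 0 <= d x y /\ (d x y = 0 <-> x = y))%R,
      (forall x y, d x y = d y x),
      (forall x y z, d x z <= d x y + d y z)%R,
      (forall x (A : set T),
        nbhs x A <-> exists2 e : R, (0 < e)%R & [set y | (d x y < e)%R] `<=` A) &
      (forall u : nat -> T,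
        (forall e : R, (0 < e)%R ->
          exists N, forall m n, (N <= m)%N -> (N <= n)%N ->
            (d (u m) (u n) < e)%R) ->
        exists l : T, u @ \oo --> l)].

Definition polish (R : realType) (T : topologicalType) : Prop :=
  (exists2 D : set T, countable D & dense D) /\
  (exists d : T -> T -> R, complete_metric d).

HB.instance Definition _ (X Y : ptopologicalType) := Pointed.on (X * Y)%type.

(* On T := X * Y this is the Borel sigma-algebra of the product topology, not
   the product sigma-algebra that the library puts on products. *)
Definition borel (T : ptopologicalType) : Type := g_sigma_algebraType (@open T).

HB.instance Definition _ (T : ptopologicalType) :=
  Measurable.copy (borel T) (g_sigma_algebraType (@open T)).

Section signed_measures.
Context d (T : measurableType d) (R : realType).

(* [%dE] is the addition of \bar R with +oo - +oo = +oo: the cost is +oo when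
   both f^\+ and f^\- have infinite integral; otherwise it is \int[m]_z f z. *)
Definition cost (m : {measure set T -> \bar R}) (f : T -> \bar R) : \bar R :=
  (\int[m]_z f^\+ z - \int[m]_z f^\- z)%dE.

Lemma hahn_exists (eta : {charge set T -> \bar R}) :
  exists PN : set T * set T, hahn_decomposition eta PN.1 PN.2.
Proof. by have [P [N PN]] := Hahn_decomposition eta; exists (P, N). Qed.

(* On measurable sets none of the three measures below depends on the chosen
   Hahn decomposition. *)
Definition hahn_choice (eta : {charge set T -> \bar R}) := cid (hahn_exists eta).

Definition pos_part (eta : {charge set T -> \bar R}) :
  {measure set T -> \bar R} := jordan_pos (svalP (hahn_choice eta)).

Definition neg_part (eta : {charge set T -> \bar R}) :
  {measure set T -> \bar R} := jordan_neg (svalP (hahn_choice eta)).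

Definition abs_charge (eta : {charge set T -> \bar R}) : set T -> \bar R :=
  charge_variation (svalP (hahn_choice eta)).

Definition signed_cost (eta : {charge set T -> \bar R}) (f : T -> \bar R) :
  \bar R := (cost (pos_part eta) f - cost (neg_part eta) f)%dE.

End signed_measures.

(* Charges are finite by definition; for a finite measure on a Hausdorff space,
   inner regularity entails outer regularity. *)
Definition radon (R : realType) (T : ptopologicalType)
    (eta : {charge set (borel T) -> \bar R}) : Prop :=
  forall A : set (borel T), measurable A ->
    abs_charge eta A =
    ereal_sup [set abs_charge eta K | K in [set K | @compact T K /\ K `<=` A]].

Section transport.
Context (R : realType) (X Y : ptopologicalType).
Variables (mu : probability (borel X) R) (nu : probability (borel Y) R).

Definition couplings : set (probability (borel (X * Y)%type) R) :=
  [set pi |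
    (forall A : set (borel X), measurable A -> pi (fst @^-1` A) = mu A) /\
    (forall B : set (borel Y), measurable B -> pi (snd @^-1` B) = nu B)].

Definition optimal_plan (c : X * Y -> \bar R)
    (pi : probability (borel (X * Y)%type) R) : Prop :=
  couplings pi /\ forall gamma, couplings gamma -> cost pi c <= cost gamma c.

(* The library's measures are functions on all sets, so equality of measures is
   asserted on measurable sets only. *)
Definition radial_cone (pi : probability (borel (X * Y)%type) R) :
    set ({charge set (borel (X * Y)%type) -> \bar R}) :=
  [set eta | radon eta /\
    exists2 t : R, (0 < t)%R & exists2 gamma, couplings gamma &
      forall A, measurable A -> gamma A = pi A + t%:E * eta A].

End transport.

(* Main.v *)
(* If gamma = pi + t eta with gamma, pi >= 0 and t > 0, then t eta^- <= pi, so
   C(eta^-) is finite, and integrating c^+ and c^- against the identity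
   gamma + t eta^- = pi + t eta^+ shows C(pi) <= C(gamma) iff C(eta) >= 0, the
   infinite values of the integrals against eta^+ and gamma matching up. It
   remains that gamma - pi is Radon for every coupling gamma: X * Y is Hausdorff
   and has a countable network of compact sets, so that open sets are
   sigma-compact and every finite Borel measure is inner regular. *)
Require Import Defs.
From HB Require Import structures.
From mathcomp Require Import all_boot all_order all_algebra.
From mathcomp Require Import all_classical all_reals all_analysis.
From mathcomp Require Import measurable_realfun.
From mathcomp Require Import ring.

Set Implicit Arguments.
Unset Strict Implicit.
Unset Printing Implicit Defensive.

Import Order.TTheory GRing.Theory Num.Theory.
Local Open Scope classical_set_scope.
Local Open Scope ring_scope.
Local Open Scope ereal_scope.

(** * Hausdorff spaces and countable networks of compact sets *)

(** A network asks less than a base: its members need not be open, which lets them be compact. *)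
Definition compact_network (T : topologicalType) (F : nat -> set T) : Prop :=
  (forall n, compact (F n)) /\
  (forall x A, nbhs x A -> exists2 n, F n x & F n `<=` A).

Lemma complete_metric_hausdorff (R : realType) (T : topologicalType)
  (d : T -> T -> R) : complete_metric d -> hausdorff_space T.
Proof.
move=> [d0 dC dT dN _] p q pq.
have [dpq0 dpqE] := d0 p q; apply/dpqE/eqP; rewrite eq_le dpq0 andbT leNgt.
apply/negP => dpq_gt0; set e := (d p q / 2)%R.
have e0 : (0 < e)%R by rewrite divr_gt0.
have [||x [/= px qx]] := pq [set y | (d p y < e)%R] [set y | (d q y < e)%R].
- by apply/dN; exists e.
- by apply/dN; exists e.
have := dT p x q; rewrite [d x q]dC leNgt => /negP; apply.
by rewrite (lt_le_trans (ltrD px qx))// -splitr.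
Qed.

Lemma hausdorff_space_prod (X Y : topologicalType) :
  hausdorff_space X -> hausdorff_space Y -> hausdorff_space (X * Y)%type.
Proof.
move=> hX hY [x y] [x' y'] xy; congr pair.
- apply: hX => A B xA xB.
  have [||[a b] [/= Aa Ba]] := xy (A `*` setT) (B `*` setT).
  + by exists (A, setT) => //; split => //; exact: filterT.
  + by exists (B, setT) => //; split => //; exact: filterT.
  + by exists a; split; [case: Aa|case: Ba].
- apply: hY => A B xA xB.
  have [||[a b] [/= Aa Ba]] := xy (setT `*` A) (setT `*` B).
  + by exists (setT, A) => //; split => //; exact: filterT.
  + by exists (setT, B) => //; split => //; exact: filterT.
  + by exists b; split; [case: Aa|case: Ba].
Qed.

Lemma polish_hausdorff (R : realType) (T : topologicalType) :
  polish R T -> hausdorff_space T.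
Proof. by move=> [_ [d]] /complete_metric_hausdorff. Qed.

(* The members of the network are the compact ones among the closed balls of
   radius 1/(n+1) centred at a countable dense set. *)
Lemma polish_compact_network (R : realType) (T : topologicalType) :
  polish R T -> locally_compact [set: T] ->
  exists F : nat -> set T, compact_network F.
Proof.
move=> [[D /countable_injP[f injf] dD] [d [d0 dC dT dN _]]] lcT.
pose B q k := [set y | (d q y <= k.+1%:R^-1)%R].
have clB q k : closed (B q k).
  move=> y clBy; rewrite /B /= leNgt; apply/negP => lty.
  have e0 : (0 < d q y - k.+1%:R^-1)%R by rewrite subr_gt0.
  have [|z [/= Bz yz]] := clBy [set z | (d y z < d q y - k.+1%:R^-1)%R].
    by apply/dN; exists (d q y - k.+1%:R^-1)%R.
  have := dT q z y; rewrite [d z y]dC leNgt => /negP; apply.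
  by rewrite (le_lt_trans (lerD Bz (lexx _)))// -ltrBrDl.
(* As [f] is injective on [D], [G i k] is the ball [B q k] if [i] codes a [q] in [D] whose ball is
   compact, and is empty otherwise. *)
pose G (i k : nat) := [set y | exists q,
  [/\ D q, f q = i, B q k y & compact (B q k)]].
have Gcompact i k : compact (G i k).
  have [[q [Dq fq cB]]|nq] :=
      pselect (exists q, [/\ D q, f q = i & compact (B q k)]).
    suff -> : G i k = B q k by [].
    apply/seteqP; split=> y; last by exists q.
    move=> [q' [Dq' fq' + _]]; suff -> : q' = q by [].
    by apply: injf; rewrite ?inE// fq' fq.
  suff -> : G i k = set0 by exact: compact0.
  by apply/seteqP; split=> y // -[q [? ? _ ?]]; apply: nq; exists q.
exists (fun n => if unpickle n is Some (i, k) then G i k else set0).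
split=> [n|x A xA]; first by case: unpickle => [[i k]|]//; exact: compact0.
have [C xC [cC _]] := lcT x Logic.I.
(* A closed ball inside [A] and the compact neighbourhood [C] at once is both small enough and
   compact. *)
have /dN[e e0 eAC] : nbhs x (A `&` C).
  apply: filterI => //.
  by apply: (@filterS _ _ _ [set y | [set: T] y -> C y]) xC => y; exact.
(* With 1/(k+1) < e/2 and [q] within 1/(k+1) of [x], the ball [B q k] contains [x] and stays within
   distance [e] of it. *)
have [k _ /(_ k (leqnn k)) /= ke] :=
  near_infty_natSinv_lt (PosNum (divr_gt0 e0 (ltr0n R 2))).
have [q [xq Dq]] : [set y | (d x y < k.+1%:R^-1)%R]° `&` D !=set0.
  apply: dD; last exact: open_interior.
  by exists x; apply/dN; exists k.+1%:R^-1%R => //; rewrite invr_gt0.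
have {}xq : (d x q < k.+1%:R^-1)%R by move/interior_subset : xq.
have BAC : B q k `<=` A `&` C.
  move=> y By; apply: eAC => /=; rewrite (le_lt_trans (dT x q y))//.
  by rewrite [e]splitr (lt_trans (ltr_leD xq By))// ltrD.
exists (pickle (f q, k)); rewrite pickleK.
  exists q; split => //; first by rewrite /B /= dC ltW.
  by apply: (subclosed_compact _ cC) => // y /BAC[].
by move=> y [q' [Dq' fq' +]] _; rewrite (injf q' q) ?inE// => /BAC[].
Qed.

Lemma compact_network_prod (X Y : topologicalType) (F : nat -> set X)
    (G : nat -> set Y) : compact_network F -> compact_network G ->
  exists H : nat -> set (X * Y)%type, compact_network H.
Proof.
move=> [cF nF] [cG nG].
exists (fun n => if unpickle n is Some (i, j) then F i `*` G j else set0).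
split=> [n|[x y] A [[U V] [/= xU yV] UVA]].
  case: unpickle => [[i j]|]; last exact: compact0.
  exact: compact_setX.
have [i Fx FU] := nF _ _ xU; have [j Gy GV] := nG _ _ yV.
exists (pickle (i, j)); rewrite pickleK//.
by move=> [a b] [/= /FU Ua /GV Vb]; exact: UVA.
Qed.

(** The members of the network that lie inside [U] cover [U]; the others are replaced by the empty
    set. *)
Lemma open_bigcup_compact (T : topologicalType) (F : nat -> set T) (U : set T) :
  compact_network F -> open U ->
  exists2 K : nat -> set T, (forall n, compact (K n)) & U = \bigcup_n K n.
Proof.
move=> [cF nF] oU.
exists (fun n => if pselect (F n `<=` U) then F n else set0).
  by move=> n; case: pselect => FnU; [exact: cF|exact: compact0].
apply/seteqP; split=> [x Ux|x [n _]].
  have [n Fnx FnU] := nF x U (open_nbhs_nbhs (conj oU Ux)).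
  by exists n => //; case: pselect.
by case: pselect => // FnU /FnU.
Qed.

(** * Inner regularity of finite Borel measures *)

Section inner_regularity.
Context (R : realType) (T : ptopologicalType).
Variable m : {measure set (borel T) -> \bar R}.
Hypothesis m_fin : m setT < +oo.
Hypothesis hT : hausdorff_space T.

(** Bounding the measure of the difference, rather than taking a supremum, lets the errors be added
    by subadditivity. *)
Definition inner_regular (A : set T) := forall e : R, (0 < e)%R ->
  exists2 K : set T, compact K /\ K `<=` A & m (A `\` K) <= e%:E.

Lemma compact_borel (K : set T) : compact K -> measurable (K : set (borel T)).
Proof.
move=> cK; rewrite -(setCK K); apply: measurableC; apply: sub_sigma_algebra.
by apply: closed_openC; exact: compact_closed.
Qed.

Lemma compact_inner_regular (K : set T) : compact K -> inner_regular K.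
Proof.
by move=> cK e e0; exists K; [split|rewrite setDv measure0 lee_fin ltW].
Qed.

Lemma inner_regular_family (A : nat -> set T) (e : R) : (0 < e)%R ->
    (forall n, measurable (A n : set (borel T))) ->
    (forall n, inner_regular (A n)) ->
  exists2 K : nat -> set T, (forall n, compact (K n) /\ K n `<=` A n) &
    m (\bigcup_n (A n `\` K n)) <= e%:E.
Proof.
move=> e0 mA rA.
(* The errors e/2^(n+1) sum to [e]. *)
have en n : (0 < e / (2 ^ n.+1)%:R)%R by rewrite divr_gt0// ltr0n expn_gt0.
pose K n := sval (cid2 (rA n _ (en n))).
have KP n : compact (K n) /\ K n `<=` A n by rewrite /K; case: cid2.
have mK n : m (A n `\` K n) <= (e / (2 ^ n.+1)%:R)%:E.
  by rewrite /K; case: cid2.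
have mD n : measurable (A n `\` K n : set (borel T)).
  by apply: measurableD => //; apply: compact_borel; have [] := KP n.
exists K => //.
apply: (@le_trans _ _ (\sum_(n <oo) m (A n `\` K n))).
  by apply: measure_sigma_subadditive => //; exact: bigcupT_measurable.
apply: (le_trans _ (epsilon_trick0 xpredT (ltW e0))).
by apply: lee_nneseries => // n _; exact: measure_ge0.
Qed.

(** Continuity from above: the tails decrease to the empty set, and [m] is finite. *)
Lemma measure_bigcup_tail (A : nat -> set T) (e : R) : (0 < e)%R ->
    (forall n, measurable (A n : set (borel T))) ->
  exists n, m (\bigcup_k A k `\` \big[setU/set0]_(k < n) A k) <= e%:E.
Proof.
move=> e0 mA.
pose B n := \bigcup_k A k `\` \big[setU/set0]_(k < n) A k.
have mB n : measurable (B n : set (borel T)).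
  apply: measurableD; first exact: bigcupT_measurable.
  exact: bigsetU_measurable.
have B0 : \bigcap_n B n = set0.
  apply/seteqP; split=> // x Bx; have [[k _ Akx] _] := Bx 0%N Logic.I.
  have [_] := Bx k.+1 Logic.I; apply.
  by rewrite -bigcup_mkord; exists k => /=.
have : m \o B @ \oo --> m (\bigcap_n B n).
  apply: nonincreasing_cvg_mu => //.
  - by rewrite (le_lt_trans _ m_fin)// le_measure// inE.
  - by rewrite B0.
  - move=> i j ij; apply/subsetPset; apply: setDS.
    exact: subset_bigsetU.
rewrite B0 measure0 => /(_ [set x | x < e%:E])[|n _ /(_ n (leqnn n)) /= Bn].
  by apply: open_ereal_lt'; rewrite lte_fin.
by exists n; exact: ltW.
Qed.

(** An infinite union of compact sets need not be compact, so only finitely many [K k] are kept: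
    half of [e] pays for the tail, half for the sets [A k] minus [K k]. *)
Lemma inner_regular_bigcup (A : nat -> set T) :
  (forall n, measurable (A n : set (borel T))) ->
  (forall n, inner_regular (A n)) -> inner_regular (\bigcup_n A n).
Proof.
move=> mA rA e e0; have e20 : (0 < e / 2)%R by rewrite divr_gt0.
have [K KA mK] := inner_regular_family e20 mA rA.
have [n mn] := measure_bigcup_tail e20 mA.
exists (\big[setU/set0]_(k < n) K k).
  split; first by apply: bigsetU_compact => i _; have [] := KA i.
  rewrite -bigcup_mkord => x [k _ Kx]; exists k => //.
  by have [_] := KA k; exact.
have mKn k : measurable (K k : set (borel T)).
  by apply: compact_borel; have [] := KA k.
have mU := bigcupT_measurable _ mA.
have mDK := bigcupT_measurable _ (fun k => measurableD (mA k) (mKn k)).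
apply: (@le_trans _ _ (m ((\bigcup_k A k `\` \big[setU/set0]_(k < n) A k) `|`
    \bigcup_k (A k `\` K k)))).
  apply: le_measure; rewrite ?inE.
  - by apply: measurableD => //; exact: bigsetU_measurable.
  - by apply: measurableU => //; apply: measurableD => //;
      exact: bigsetU_measurable.
  move=> x [Ax nKx]; have [Anx|] := pselect ((\big[setU/set0]_(k < n) A k) x).
    right; move: Anx; rewrite -bigcup_mkord => -[k /= kn Akx]; exists k => //.
    by split=> // Kkx; apply: nKx; rewrite -bigcup_mkord; exists k.
  by left.
rewrite [e]splitr EFinD; apply: le_trans (leeD mn mK).
by apply: measureU2 => //; apply: measurableD => //; exact: bigsetU_measurable.
Qed.

(** The intersection of the [K n] is already compact, and a point of the intersection of the [A n]
    outside it misses some [K n]. *)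
Lemma inner_regular_bigcap (A : nat -> set T) :
  (forall n, measurable (A n : set (borel T))) ->
  (forall n, inner_regular (A n)) -> inner_regular (\bigcap_n A n).
Proof.
move=> mA rA e e0; have [K KA mK] := inner_regular_family e0 mA rA.
have mKn k : measurable (K k : set (borel T)).
  by apply: compact_borel; have [] := KA k.
exists (\bigcap_n K n).
  split; last by move=> x Kx n _; have [_] := KA n; apply; exact: Kx.
  apply: (@subclosed_compact _ _ (K 0%N)).
  - by apply: closed_bigI => n _; apply: compact_closed => //; have [] := KA n.
  - by have [] := KA 0%N.
  - by move=> x /(_ 0%N Logic.I).
apply: le_trans mK; apply: le_measure; rewrite ?inE.
- by apply: measurableD; exact: bigcapT_measurable.
- by apply: bigcupT_measurable => k; exact: measurableD.
move=> x [Ax /existsNP[n /not_implyP[_ nKx]]]; exists n => //.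
by split => //; exact: Ax.
Qed.

Lemma borel_inner_regular (F : nat -> set T) (A : set T) :
  compact_network F -> measurable (A : set (borel T)) -> inner_regular A.
Proof.
move=> nF.
have rU (U : set T) : open U -> inner_regular U.
  move=> /(open_bigcup_compact nF)[K cK ->]; apply: inner_regular_bigcup => n.
    exact: compact_borel.
  exact: compact_inner_regular.
(* The whole space is a countable union of compact sets, so a closed set is the union of its compact
   traces on them. *)
have rC (C : set T) : closed C -> inner_regular C.
  move=> cC; have [K cK KT] := open_bigcup_compact nF openT.
  have cCK n : compact (C `&` K n).
    apply: (subclosed_compact _ (cK n)) => [|x []//].
    by apply: closedI => //; exact: compact_closed.
  rewrite -(setIT C) KT setI_bigcupr; apply: inner_regular_bigcup => n.
    exact: compact_borel.
  exact: compact_inner_regular.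
(* Complements are built into [E], since inner regularity of a set says nothing direct about its
   complement; for a countable union the complement is handled by [inner_regular_bigcap]. *)
pose E := [set A : set T | [/\ measurable (A : set (borel T)),
  inner_regular A & inner_regular (~` A)]].
suff mE : (measurable : set (set (borel T))) `<=` E by move=> /mE[].
apply: smallest_sub => [|U oU]; last first.
  by split; [exact: sub_sigma_algebra|exact: rU|exact/rC/open_closedC].
split.
- split; [exact: measurable0|exact/rU/open0|].
  by rewrite setC0; exact/rU/openT.
- move=> B [mB rB rCB]; rewrite setTD; split => //; first exact: measurableC.
  by rewrite setCK.
- move=> B EB; have mB n : measurable (B n : set (borel T)) by case: (EB n).
  split; first exact: bigcupT_measurable.
    by apply: inner_regular_bigcup => // n; case: (EB n).
  rewrite setC_bigcup; apply: inner_regular_bigcap => n.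
    exact: measurableC.
  by case: (EB n).
Qed.

Lemma inner_regular_sup (A : set T) :
    measurable (A : set (borel T)) -> inner_regular A ->
  m A = ereal_sup [set m K | K in [set K : set T | compact K /\ K `<=` A]].
Proof.
move=> mA rA; apply/eqP; rewrite eq_le; apply/andP; split; last first.
  apply: ge_ereal_sup => _ [K [cK KA] <-].
  by apply: le_measure; rewrite ?inE//; exact: compact_borel.
apply/lee_addgt0Pr => e e0; have [K [cK KA] mK] := rA e e0.
have mK' := compact_borel cK.
rewrite -{1}(setDUK KA).
apply: (le_trans (measureU2 m mK' (measurableD mA mK'))).
by apply: leeD => //; apply: ereal_sup_ubound => /=; exists K.
Qed.

End inner_regularity.

(** * Charges and their Jordan parts *)

Lemma pos_part_fin d (T : measurableType d) (R : realType)
    (eta : {charge set T -> \bar R}) (A : set T) :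
  measurable A -> pos_part eta A \is a fin_num.
Proof. exact: (fin_num_measure (jordan_pos (svalP (hahn_choice eta)))). Qed.

Lemma neg_part_fin d (T : measurableType d) (R : realType)
    (eta : {charge set T -> \bar R}) (A : set T) :
  measurable A -> neg_part eta A \is a fin_num.
Proof. exact: (fin_num_measure (jordan_neg (svalP (hahn_choice eta)))). Qed.

Lemma charge_radon (R : realType) (T : ptopologicalType) (F : nat -> set T)
    (eta : {charge set (borel T) -> \bar R}) :
  hausdorff_space T -> compact_network F -> radon eta.
Proof.
move=> hT nF A mA.
(* The variation is recast as a sum of two finite measures, to which inner regularity applies. *)
have -> : abs_charge eta = measure_add (pos_part eta) (neg_part eta).
  by apply/funext => B; rewrite measure_addE.
have fin : measure_add (pos_part eta) (neg_part eta) setT < +oo.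
  by rewrite measure_addE lte_add_pinfty// ltey_eq ?pos_part_fin ?neg_part_fin.
by apply: inner_regular_sup => //; exact: borel_inner_regular nF mA.
Qed.

Lemma charge_pos_neg_part d (T : measurableType d) (R : realType)
    (eta : {charge set T -> \bar R}) (A : set T) : measurable A ->
  eta A = pos_part eta A - neg_part eta A.
Proof.
move=> mA; rewrite (jordan_decomp (svalP (hahn_choice eta)) mA)/=.
by rewrite /cadd/= /cscale EFinN mulN1e.
Qed.

(** * Costs along a perturbation of a measure by a charge *)

Section perturbation.
Context d (T : measurableType d) (R : realType).
Variables (gamma : {measure set T -> \bar R}).
Variables (pi : {finite_measure set T -> \bar R}).
Variables (eta : {charge set T -> \bar R}) (t : R).
Hypothesis t_gt0 : (0 < t)%R.
Hypothesis gammaE : forall A, measurable A -> gamma A = pi A + t%:E * eta A.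

Let tn : {nonneg R} := NngNum (ltW t_gt0).

(** On the negative set [N] of the Hahn decomposition, nonnegativity of [gamma (A]&[N)] bounds the
    mass that [t] times [eta] removes by [pi (A]&[N)]. *)
Lemma neg_part_le (A : set T) : measurable A ->
  mscale tn (neg_part eta) A <= pi A.
Proof.
move=> mA; rewrite /mscale/= /neg_part; case: (hahn_choice eta) => -[P N] /= PN.
have [_ [mN _] _ _] := PN; have mAN := measurableI _ _ mA mN.
rewrite jordan_negE cjordan_negE /crestr0 mem_set// /crestr muleN.
have ge0 : 0 <= gamma (A `&` N) by exact: measure_ge0.
rewrite gammaE// in ge0.
apply: (@le_trans _ _ (pi (A `&` N))).
  by rewrite -sube_ge0 ?oppeK// fin_numN fin_numM// fin_num_measure.
by apply: le_measure; rewrite ?inE.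
Qed.

(** Moving the negative part to the left leaves an equality of two positive measures, so it can be
    integrated even where integrals are infinite. *)
Lemma perturbation_integral (f : T -> \bar R) :
    measurable_fun setT f -> (forall x, 0 <= f x) ->
  \int[gamma]_x f x + t%:E * \int[neg_part eta]_x f x =
  \int[pi]_x f x + t%:E * \int[pos_part eta]_x f x.
Proof.
(* Reading [t] as the value of [tn] lets the scalar factors be absorbed into scaled measures. *)
move=> mf f0; rewrite -[t]/(tn%:num)%R -!ge0_integral_mscale//.
rewrite -!ge0_integral_measure_add//; apply: eq_measure_integral => A mA _.
transitivity (gamma A + t%:E * neg_part eta A); first exact: measure_addE.
transitivity (pi A + t%:E * pos_part eta A); last exact/esym/measure_addE.
rewrite gammaE// charge_pos_neg_part// -addeA -muleDr ?subeK ?neg_part_fin//.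
by rewrite fin_num_adde_defl// neg_part_fin.
Qed.

Lemma neg_part_integral_le (f : T -> \bar R) :
    measurable_fun setT f -> (forall x, 0 <= f x) ->
  t%:E * \int[neg_part eta]_x f x <= \int[pi]_x f x.
Proof.
move=> mf f0; rewrite -[t]/(tn%:num)%R -ge0_integral_mscale//.
by apply: ge0_le_measure_integral => // A; exact: neg_part_le.
Qed.

Lemma neg_part_integral_fin (f : T -> \bar R) :
    measurable_fun setT f -> (forall x, 0 <= f x) ->
    \int[pi]_x f x \is a fin_num -> \int[neg_part eta]_x f x \is a fin_num.
Proof.
move=> mf f0 pif; have := neg_part_integral_le mf f0.
have : 0 <= \int[neg_part eta]_x f x by apply: integral_ge0.
case: (\int[neg_part eta]_x f x) => //= _; rewrite gt0_muley ?lte_fin//.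
by rewrite leye_eq => /eqP piy; rewrite piy in pif.
Qed.

Lemma signed_cost_ge0 (c : T -> \bar R) :
    measurable_fun setT c -> cost pi c \is a fin_num ->
  0 <= signed_cost eta c <-> cost pi c <= cost gamma c.
Proof.
move=> mc; rewrite /signed_cost /cost.
have mp : measurable_fun setT c^\+ by exact: measurable_funepos.
have mn : measurable_fun setT c^\- by exact: measurable_funeneg.
have p0 x : 0 <= c^\+ x by exact: funepos_ge0.
have n0 x : 0 <= c^\- x by exact: funeneg_ge0.
move: (perturbation_integral mp p0) (perturbation_integral mn n0).
move: (neg_part_integral_fin mp p0) (neg_part_integral_fin mn n0).
have : 0 <= \int[pi]_x c^\+ x by apply: integral_ge0.
have : 0 <= \int[pi]_x c^\- x by apply: integral_ge0.
have : 0 <= \int[gamma]_x c^\+ x by apply: integral_ge0.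
have : 0 <= \int[gamma]_x c^\- x by apply: integral_ge0.
have : 0 <= \int[pos_part eta]_x c^\+ x by apply: integral_ge0.
have : 0 <= \int[pos_part eta]_x c^\- x by apply: integral_ge0.
(* Finiteness of [cost pi c] leaves only real values here, since [%dE] makes the difference infinite
   as soon as one of the two integrals is. *)
move: (\int[pi]_x c^\+ x) (\int[pi]_x c^\- x) => [P| |] [P'| |] //=.
move: (\int[gamma]_x c^\+ x) (\int[gamma]_x c^\- x) => G G'.
move: (\int[pos_part eta]_x c^\+ x) (\int[pos_part eta]_x c^\- x) => Q Q'.
(* P, G, Q, N (resp. primed) are the integrals of c^\+ (resp. c^\-) with respect
   to pi, gamma, eta^+, eta^-. *)
move=> Q'0 Q0 G'0 G0 _ _ /(_ isT) + /(_ isT).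
case: (\int[neg_part eta]_x c^\+ x) => [N _|//|//].
case: (\int[neg_part eta]_x c^\- x) => [N' _|//|//].
have t0 : 0 < t%:E by rewrite lte_fin.
(* As P, N and their primed versions are real, the two identities make Q and G infinite together,
   and likewise Q' and G'; mismatched cases are contradictory. *)
case: Q Q0 => [Q| |] // _; case: G G0 => [G| |] // _;
  case: Q' Q'0 => [Q'| |] // _; case: G' G'0 => [G'| |] // _;
  rewrite ?gt0_muley//=.
(* [//=] closed the case Q < +oo, Q' = +oo, where both costs are -oo. *)
- move=> [e1] [e2] _.
  change (((0 <= Q - Q' - (N - N'))%R) <-> ((P - P' <= G - G')%R)).
  rewrite -[in X in _ <-> X]subr_ge0.
  (* Solving the two identities for G and G' shows that the cost changes by [t] times the signed
     cost. *)
  suff -> : (G - G' - (P - P') = t * (Q - Q' - (N - N')))%R.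
    by rewrite pmulr_rge0.
  by rewrite -(addrK (t * N)%R G) e1 -(addrK (t * N')%R G') e2; ring.
(* In this case and the next Q and G are +oo, hence so are the signed cost and the cost of [gamma];
   when Q' and G' are +oo too, this is the convention of [%dE]. *)
- by move=> _ _ _; split=> _; exact: leey.
- by move=> _ _ _; split=> _; exact: leey.
Qed.

End perturbation.

(** * Optimality and the radial cone *)

Lemma locally_compact_polish_prod_radon (R : realType) (X Y : ptopologicalType)
    (eta : {charge set (borel (X * Y)%type) -> \bar R}) :
  polish R X -> locally_compact [set: X] ->
  polish R Y -> locally_compact [set: Y] -> radon eta.
Proof.
move=> polX lcX polY lcY.
have [F nF] := polish_compact_network polX lcX.
have [G nG] := polish_compact_network polY lcY.
have [H nH] := compact_network_prod nF nG.
apply: charge_radon nH; apply: hausdorff_space_prod.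
  exact: polish_hausdorff polX.
exact: polish_hausdorff polY.
Qed.

Theorem proposition1 (R : realType) (X Y : ptopologicalType)
    (polX : polish R X) (lcX : locally_compact [set: X])
    (polY : polish R Y) (lcY : locally_compact [set: Y])
    (mu : probability (borel X) R) (nu : probability (borel Y) R)
    (c : borel (X * Y)%type -> \bar R)
    (c_ninfty : forall z, c z != -oo) (mc : measurable_fun [set: borel (X * Y)%type] c)
    (pi : probability (borel (X * Y)%type) R)
    (pi_coupling : couplings mu nu pi) (pi_fin : cost pi c \is a fin_num) :
  optimal_plan mu nu c pi <->
  (forall eta, radial_cone mu nu pi eta -> 0 <= signed_cost eta c).
Proof.
split=> [[_ pi_min] eta [_ [t t0 [gamma cgamma gammaE]]]|eta_ge0].
  by apply/(signed_cost_ge0 t0 gammaE mc pi_fin)/pi_min.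
split=> // gamma cgamma.
(* The direction from [pi] to the competitor [gamma] is their difference, and [gamma] is reached at
   t = 1. *)
pose eta : {charge set (borel (X * Y)%type) -> \bar R} :=
  cadd (charge_of_finite_measure gamma)
       (cscale (-1) (charge_of_finite_measure pi)).
have gammaE A : measurable A -> gamma A = pi A + 1%:E * eta A.
  move=> mA; have -> : eta A = gamma A + (-1)%:E * pi A by [].
  by rewrite mul1e EFinN mulN1e addeC subeK// fin_num_measure.
apply/(signed_cost_ge0 ltr01 gammaE mc pi_fin)/eta_ge0; split.
  exact: locally_compact_polish_prod_radon.
by exists 1%R; [exact: ltr01|exists gamma].
Qed.
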